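(* For any positive integers $m,n$, the poset $(N(m,n),<)$ has a symmetric chain decomposition into $\{C_\alpha : \alpha\in S_{m,n}\}$. That is: (i) $N(m,n)=\bigcup_{\alpha\in S_{m,n}} C_\alpha$; (ii) this union is disjoint, i.e. $C_\alpha\cap C_\beta=\emptyset$ for distinct $\alpha,\beta\in S_{m,n}$; (iii) $\operatorname{rank}(S(C_\alpha))+\operatorname{rank}(E(C_\alpha))=mn$ for every $\alpha\in S_{m,n}$.
   Context: Let $m,n$ be positive integers. $N(m,n)$ is the set of all integer vectors $\alpha=(\alpha_1,\dots,\alpha_m)$ with $0\le\alpha_i\le n$ for all $i$. The order is: $\beta<\alpha$ if and only if $\beta_i\le\alpha_i$ for $i=1,\dots,m$ and $\sum_{i=1}^m\beta_i<\sum_{i=1}^m\alpha_i$. The rank is $\operatorname{rank}(\alpha)=\sum_{i=1}^m\alpha_i$, so the rank of the poset $N(m,n)$ (its maximum rank) is $mn$. Elements $x_1,\dots,x_k$ of a graded poset $P$ form a symmetric chain if $x_{i+1}$ covers $x_i$ for all $1\le i\le k-1$ and $\operatorname{rank}(x_1)+\operatorname{rank}(x_k)=\operatorname{rank}(P)$. A symmetric chain decomposition of $P$ is an expression of $P$ as a disjoint union of symmetric chains. The index set $S_{m,n}$ is the set of $\alpha\in N(m,n)$ with $\alpha_m=0$, $\sum_{i=1}^m\alpha_i=k$ for some $0\le k\le\lfloor mn/2\rfloor$, and $\sum_{i=t}^{m-1}\alpha_i\le\sum_{i=t+1}^m(n-\alpha_i)$ for every $1\le t\le m-1$. For $\alpha\in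 S_{m,n}$ the tableau $C_\alpha$ is built as follows. Take an array of cells with $m$ rows (row $1$ at the top, row $m$ at the bottom) and $n$ columns. For each $i$, the first (leftmost) $\alpha_i$ cells of row $i$ are called fixed. Then, successively for $i=1,2,\dots,m-1$: starting at row $i+1$, read the cells that are neither fixed nor already declared forbidden, from right to left within each row and rows from top to bottom (rows $i+1,i+2,\dots,m$), and declare the first $\alpha_i$ of them forbidden (the forbidden cells for $\alpha_i$). For $\alpha \in S_{m,n}$ there are always enough cells to do this. The cells that are neither fixed nor forbidden are called fillable. Fill the fillable cells successively with $1,2,3,\dots,\ell$ (where $\ell$ is their number), from left to right within each row and rows from bottom to top. The tableau $C_\alpha$ is identified with the chain (also denoted $C_\alpha$) $\alpha=\alpha^{(0)}<\alpha^{(1)}<\dots<\alpha^{(\ell)}$ in $N(m,n)$, where the $i$-th coordinate of $\alpha^{(r)}$ is $\alpha_i$ plus the number of fillable cells of row $i$ whose entry is at most $r$. Let $\alpha^E_i$ be the number of forbidden cells in row $i$ (so $\alpha^E_1=0$). The starting point of $C_\alpha$ is $S(C_\alpha)=\alpha$ and the end point is $E(C_\alpha)=(n-\alpha^E_1,\dots,n-\alpha^E_m)$. *)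

(* Defs.v *)
From HB Require Import structures.
From mathcomp Require Import all_boot all_order.

Set Implicit Arguments.
Unset Strict Implicit.
Unset Printing Implicit Defensive.

Section SymmetricChains.
Variables (d : Order.disp_t) (P : finPOrderType d) (rk : P -> nat).

Definition covered_by (x y : P) : bool :=
  (x < y)%O && [forall z, ~~ ((x < z)%O && (z < y)%O)].

Definition poset_rank : nat := \max_(x : P) rk x.

Definition symmetric_chain (s : seq P) : bool :=
  if s is x :: s' then
    path covered_by x s' && (rk x + rk (last x s') == poset_rank)
  else false.

(* The chains are given as a family indexed by a finite set [A]; distinct
   indices must give disjoint chains, so the family is also injective on [A]. *)
Definition symmetric_chain_decomposition (I : finType) (A : {set I})
    (C : I -> seq P) : Prop :=
  [/\ forall i, i \in A -> symmetric_chain (C i),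
      forall x : P, exists2 i, i \in A & x \in C i
    & forall i j, i \in A -> j \in A -> i != j -> [disjoint C i & C j]].

End SymmetricChains.

(* Coordinates, rows and columns are numbered from 0: the coordinate
   [alpha_(i+1)] of the usual 1-based numbering is [alpha i], for [i : 'I_m]. *)
Definition Nvec (m n : nat) : Type := {ffun 'I_m -> 'I_n.+1}.

HB.instance Definition _ (m n : nat) := Finite.on (Nvec m n).

Definition rank (m n : nat) (a : Nvec m n) : nat := \sum_(i < m) a i.

Definition Nlt (m n : nat) : rel (Nvec m n) :=
  fun b a => [forall i, b i <= a i] && (rank b < rank a).

Lemma Nlt_irr (m n : nat) : irreflexive (@Nlt m n).
Proof. by move=> a; rewrite /Nlt ltnn andbF. Qed.

Lemma Nlt_trans (m n : nat) : transitive (@Nlt m n).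
Proof.
move=> b a c /andP[/forallP leab ltab] /andP[/forallP lebc ltbc].
rewrite /Nlt (ltn_trans ltab ltbc) andbT.
by apply/forallP=> i; apply: leq_trans (leab i) (lebc i).
Qed.

Fact Nvec_display : Order.disp_t. Proof. exact: Order.Disp tt tt. Qed.

HB.instance Definition _ (m n : nat) :=
  Order.Lt_isPOrder.Build Nvec_display (Nvec m n) (@Nlt_irr m n) (@Nlt_trans m n).

(* In the last condition, [t : 'I_m] with [t.+1 < m] is the 1-based index
   [t + 1], which ranges over 1, ..., m - 1. *)
Definition Sset (m n : nat) : {set Nvec m n} :=
  [set a : Nvec m n |
    [&& [forall i : 'I_m, (i.+1 == m) ==> (a i == 0 :> nat)],
        rank a <= (m * n) %/ 2
      & [forall t : 'I_m, (t.+1 < m) ==>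
          (\sum_(i < m | (t <= i) && (i.+1 < m)) a i
             <= \sum_(i < m | t < i) (n - a i))]]].

Section Tableau.
Variables (m n : nat) (a : Nvec m n).

(* A cell is a pair (row, column); row 0 is the top one, column 0 the
   leftmost one. *)
Definition cell : finType := ('I_m * 'I_n)%type.

Definition fixed_cells : {set cell} := [set x : cell | x.2 < a x.1].

Definition cells_below (i : 'I_m) : seq cell :=
  [seq (r, c) | r <- [seq r : 'I_m <- enum 'I_m | i < r], c <- rev (enum 'I_n)].

Definition forbid (F : {set cell}) (i : 'I_m) : {set cell} :=
  F :|: [set x in take (a i)
           [seq x <- cells_below i | (x \notin fixed_cells) && (x \notin F)]].

Definition forbidden_cells : {set cell} :=
  foldl forbid set0 [seq i : 'I_m <- enum 'I_m | i.+1 < m].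

Definition fillable_cells : {set cell} :=
  [set x | (x \notin fixed_cells) && (x \notin forbidden_cells)].

Definition filling_order : seq cell :=
  [seq x <- [seq (r, c) | r <- rev (enum 'I_m), c <- enum 'I_n]
     | x \in fillable_cells].

(* Meaningful only for fillable cells, whose entries are 1, ..., l. *)
Definition entry (x : cell) : nat := (index x filling_order).+1.

Definition filled_upto (r : nat) (i : 'I_m) : {set cell} :=
  [set x in fillable_cells | (x.1 == i) && (entry x <= r)].

Lemma chain_coord_bound (r : nat) (i : 'I_m) : a i + #|filled_upto r i| < n.+1.
Proof.
have Da : #|[set c : 'I_n | c < a i]| = a i.
  have le_an : a i <= n by rewrite -ltnS.
  have inj : injective (widen_ord le_an) by move=> x y [/val_inj].
  rewrite -[RHS]card_ord -(card_imset _ inj).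
  apply: eq_card => c; rewrite inE; apply/idP/imsetP => [lt_ca | [j _ ->] /=].
    by exists (Ordinal lt_ca) => //; apply: val_inj.
  exact: ltn_ord.
have Df : #|filled_upto r i| <= #|~: [set c : 'I_n | c < a i]|.
  rewrite -(card_in_imset (f := snd)); last first.
    move=> [i1 c1] [i2 c2]; rewrite !inE /=.
    by move=> /and3P[_ /eqP-> _] /and3P[_ /eqP-> _] ->.
  apply/subset_leq_card/subsetP => c /imsetP[[j e]].
  by rewrite !inE /= => /and3P[/andP[nf _] /eqP<- _] ->.
by rewrite ltnS -[X in X + _]Da -[X in _ <= X]card_ord -(cardsC [set c : 'I_n | c < a i]) leq_add2l.
Qed.

Definition chain_elt (r : nat) : Nvec m n :=
  [ffun i => Ordinal (chain_coord_bound r i)].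

Definition chain : seq (Nvec m n) :=
  [seq chain_elt r | r <- iota 0 #|fillable_cells|.+1].

Definition forbidden_in_row (i : 'I_m) : nat :=
  #|[set x in forbidden_cells | x.1 == i]|.

Definition chain_start : Nvec m n := a.

Definition chain_end : Nvec m n :=
  [ffun i => Ordinal (leq_subr (forbidden_in_row i) n : n - forbidden_in_row i < n.+1)].

End Tableau.

(* Main.v *)
(* Read the rows from top to bottom, row [i] of a vector [x] being the word of
   [n - x i] closing brackets followed by [x i] opening ones.  The forbidden
   cells of [x] are the closing brackets matched by an earlier opening bracket,
   and [x] belongs to S exactly when all its opening brackets are matched.
   Moving along a chain turns unmatched closing brackets into opening ones,
   starting from the bottom, and so preserves the number [f i] of matched closing
   brackets of each row.  Conversely [x] and [f] determine the start [a] of the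
   chain through [x], by recursion from the last row: [a i] is the smaller of
   [x i] and of the number of matched closing brackets below row [i] not yet
   used by [a] below row [i]. *)
Require Import Defs.
From HB Require Import structures.
From mathcomp Require Import all_boot all_order.
From mathcomp Require Import zify.

Set Implicit Arguments.
Unset Strict Implicit.
Unset Printing Implicit Defensive.

(** * Partial sums from the top row and from the bottom row *)

Section Sums.
Variable m : nat.
Implicit Types x y f a : 'I_m -> nat.

Definition psum x k := \sum_(i < m | i < k) x i.
Definition ssum x k := \sum_(i < m | k <= i) x i.

Lemma psum0 x : psum x 0 = 0.
Proof. by rewrite /psum big_pred0. Qed.

Lemma psumS x (i : 'I_m) : psum x i.+1 = psum x i + x i.
Proof.
rewrite /psum (bigD1 i) //= addnC; congr (_ + _).
by apply: eq_bigl => j; rewrite -val_eqE /=; lia.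
Qed.

Lemma ssumS x (i : 'I_m) : ssum x i = x i + ssum x i.+1.
Proof.
rewrite /ssum (bigD1 i) //=; congr (_ + _).
by apply: eq_bigl => j; rewrite -val_eqE /=; lia.
Qed.

Lemma ssum_oversize x k : m <= k -> ssum x k = 0.
Proof. by move=> lemk; rewrite /ssum big_pred0 // => j; have := ltn_ord j; lia. Qed.

Lemma psum_ssum x k : psum x k + ssum x k = ssum x 0.
Proof.
rewrite /psum /ssum [RHS](bigID (fun i : 'I_m => i < k)) /=; congr (_ + _).
by apply: eq_bigl => j; lia.
Qed.

Lemma leq_psum {x y} k : (forall i, x i <= y i) -> psum x k <= psum y k.
Proof. by move=> le_xy; apply: leq_sum. Qed.

Lemma psum_leq_range x k l : k <= l -> psum x k <= psum x l.
Proof.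
move=> le_kl; rewrite /psum [leqRHS](bigID (fun i : 'I_m => i < k)) /=.
apply: leq_trans (leq_addr _ _); apply: eq_leq.
by apply: eq_bigl => j; lia.
Qed.

End Sums.

(** * Bracket matching expressed through row counts *)

Section Matching.
Variables m n : nat.
Implicit Types x y f a b : 'I_m -> nat.

(* Equivalently, [f i = minn (n - a i) (psum a i - psum f i)], where the last
   term counts the opening brackets of earlier rows that are still pending. *)
Definition forbids a f := forall i : 'I_m,
  [/\ a i + f i <= n, psum f i.+1 <= psum a i
    & a i + f i < n -> psum f i.+1 = psum a i].

(** The chain from [a], described without entries: filling proceeds from the bottom, so a row that
    has started forces every row below it to be full. *)
Definition fills a f x :=
  (forall i, a i <= x i /\ x i + f i <= n) /\
  (forall i j : 'I_m, i < j -> a i < x i -> x j + f j = n).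

Lemma eq_forbids a a' f f' :
  a =1 a' -> f =1 f' -> forbids a f -> forbids a' f'.
Proof.
move=> eq_a eq_f Hf i; have := Hf i; rewrite eq_a eq_f.
rewrite (_ : psum a i = psum a' i); last by apply: eq_bigr.
by rewrite (_ : psum f i.+1 = psum f' i.+1); last by apply: eq_bigr.
Qed.

Lemma eq_fills a a' f f' x :
  a =1 a' -> f =1 f' -> fills a f x -> fills a' f' x.
Proof.
move=> eq_a eq_f [Hx Hj]; split=> [i|i j]; first by rewrite -eq_a -eq_f.
by rewrite -eq_a -eq_f; apply: Hj.
Qed.

(** Matching is greedy from the top: once [psum f i] is known, row [i] matches as many closing
    brackets as it has and as are pending. *)
Lemma forbids_inj a f f' : forbids a f -> forbids a f' -> f =1 f'.
Proof.
move=> Hf Hf'.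
have eqp k : k <= m -> psum f k = psum f' k.
  elim: k => [|k IH] lekm; first by rewrite !psum0.
  have := IH (ltnW lekm); have := psumS f (Ordinal lekm).
  have := psumS f' (Ordinal lekm); have /= := Hf (Ordinal lekm).
  by have /= := Hf' (Ordinal lekm) => -[? ? ?] [? ? ?]; lia.
move=> i; have := psumS f i; have := psumS f' i.
by rewrite !eqp ?(ltnW (ltn_ord i)) //; lia.
Qed.

(** If a row above [i] is raised in [x], then row [i] is full and the equality clause is vacuous;
    otherwise [x] and [a] agree above [i] and have the same pending brackets. *)
Lemma fills_forbids a f x : forbids a f -> fills a f x -> forbids x f.
Proof.
move=> Hf [Hx Hj] i; have [ai fi ei] := Hf i; have [xi1 xi2] := Hx i.
have le_ax := leq_psum i (fun j => proj1 (Hx j)).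
split=> [//||lt_n]; first exact: leq_trans le_ax.
rewrite ei; last by lia.
apply: eq_bigr => j lt_ji; have [+ _] := Hx j.
rewrite leq_eqVlt => /orP[/eqP // | lt_ax].
by have := Hj _ _ lt_ji lt_ax; lia.
Qed.

(** With equal totals, [psum f i.+1 <= psum a i] reads [ssum a i <= ssum f i.+1]. If [a i < x i],
    row [i] has room in [a], so this is an equality and gives the second term; otherwise
    [a i = x i]. *)
Lemma fills_startE a f x (i : 'I_m) :
    forbids a f -> ssum a 0 = ssum f 0 -> fills a f x ->
  a i = minn (x i) (ssum f i.+1 - ssum a i.+1).
Proof.
move=> Hf eq_af [Hx _]; have [xi1 xi2] := Hx i; have [ai fi ei] := Hf i.
have := psum_ssum f i.+1; have := psum_ssum a i; have := ssumS a i.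
rewrite eq_af; have [lt_ax | ge_ax] := ltnP (a i) (x i); last by lia.
by have := ei; lia.
Qed.

Lemma backward_rec_exists (g : 'I_m -> nat -> nat) :
  exists a : 'I_m -> nat, forall i, a i = g i (ssum a i.+1).
Proof.
suff rec d : d <= m -> exists a : 'I_m -> nat,
    forall i : 'I_m, m - d <= i -> a i = g i (ssum a i.+1).
  by have [a Ha] := rec m (leqnn m); exists a => i; apply: Ha; lia.
elim: d => [|d IH] le_dm.
  by exists (fun=> 0) => i; have := ltn_ord i; lia.
have [a Ha] := IH (ltnW le_dm).
have lt_m : m - d.+1 < m by lia.
pose k := Ordinal lt_m.
(* Row [k] is the next one upwards; redefining it leaves the suffix sums that start below it
   intact. *)
pose b i := if i == k then g k (ssum a k.+1) else a i.
have eq_ba i : k <= i -> ssum b i.+1 = ssum a i.+1.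
  move=> le_ki; apply: eq_bigr => j lt_ij; rewrite /b ifN //.
  by move: le_ki; rewrite -val_eqE /=; lia.
exists b => i le_i; rewrite eq_ba // /b; case: eqP => [-> // | /eqP].
by rewrite -val_eqE /= => ne_i; apply: Ha; lia.
Qed.

Lemma fills_start_inj a b f x :
    forbids a f -> ssum a 0 = ssum f 0 -> fills a f x ->
    forbids b f -> ssum b 0 = ssum f 0 -> fills b f x ->
  a =1 b.
Proof.
move=> Ha sa xa Hb sb xb.
have eqs d : ssum a (m - d) = ssum b (m - d).
  elim: d => [|d IH]; first by rewrite !ssum_oversize ?subn0.
  have [le_md | lt_dm] := leqP m d.
    by have -> : m - d.+1 = m - d by lia.
  have lt_m : m - d.+1 < m by lia.
  have := fills_startE (Ordinal lt_m) Ha sa xa.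
  have := fills_startE (Ordinal lt_m) Hb sb xb.
  have := ssumS a (Ordinal lt_m); have := ssumS b (Ordinal lt_m) => /=.
  have -> : (m - d.+1).+1 = m - d by lia.
  by rewrite IH => -> -> -> ->.
move=> i; rewrite (fills_startE i Ha sa xa) (fills_startE i Hb sb xb).
by have := eqs (m - i.+1); have := ltn_ord i => lt_i; rewrite subKn // => ->.
Qed.

(** The formula of [fills_startE], read as a recursion, defines the start; two inequalities, proved
    from the bottom up, show that its total is right. *)
Lemma fills_start_exists x f : 0 < m -> forbids x f ->
  exists a, [/\ forbids a f, ssum a 0 = ssum f 0 & fills a f x].
Proof.
move=> m_gt0 Hx.
have [a aE] := backward_rec_exists (fun i s => minn (x i) (ssum f i.+1 - s)).
have le_ax i : a i <= x i by rewrite aE geq_minl.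
have sumE (y : 'I_m -> nat) k : ssum y k + psum y k = ssum y 0.
  by rewrite addnC psum_ssum.
(* The openings kept from a row on never exceed the matched closings strictly below that row. *)
have le_af d : ssum a (m - d) <= ssum f (m - d).+1.
  elim: d => [|d IH]; first by rewrite ssum_oversize ?subn0.
  have [le_md | lt_dm] := leqP m d.
    by have -> : m - d.+1 = m - d by lia.
  have lt_m : m - d.+1 < m by lia.
  have := ssumS a (Ordinal lt_m); have := aE (Ordinal lt_m) => /=.
  have := sumE f (m - d); have := sumE f (m - d).+1.
  have := psum_leq_range f (leqnSn (m - d)).
  have -> : (m - d.+1).+1 = m - d by lia.
  lia.
(* Each row either keeps all openings of [x] or uses up the matched closings below it. At [d = m]
   this bounds [ssum f 0] by [ssum a 0]. *)
have le_fxa d : ssum f 0 <= ssum a (m - d) + psum x (m - d).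
  elim: d => [|d IH].
    have lt_m : m.-1 < m by lia.
    have [_ + _] := Hx (Ordinal lt_m); have := psum_leq_range x (ltnW lt_m).
    have := sumE f m; rewrite subn0 !(ssum_oversize _ (leqnn m)) /=.
    by rewrite (ltn_predK m_gt0) => <- ? /leq_trans-> //.
  have [le_md | lt_dm] := leqP m d.
    by have -> : m - d.+1 = m - d by lia.
  have lt_m : m - d.+1 < m by lia.
  have := ssumS a (Ordinal lt_m); have := aE (Ordinal lt_m).
  have := psumS x (Ordinal lt_m); have [_ + _] := Hx (Ordinal lt_m) => /=.
  have := sumE f (m - d).
  have -> : (m - d.+1).+1 = m - d by lia.
  lia.
have eq_af : ssum a 0 = ssum f 0.
  have := sumE f 1; have := psum0 x.
  by have := le_af m; have := le_fxa m; rewrite subnn; lia.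
have Pf (i : 'I_m) : psum f i.+1 <= psum a i.
  have lt_i := ltn_ord i; have := le_af (m - i); rewrite (subKn (ltnW lt_i)).
  by have := sumE a i; have := sumE f i.+1; lia.
have Pe (i : 'I_m) : a i < x i -> psum f i.+1 = psum a i.
  have := aE i; have := Pf i; have := sumE a i; have := sumE f i.+1.
  by have := ssumS a i; lia.
exists a; split=> //.
- move=> i; have [xi fi ei] := Hx i; have le_i := le_ax i; split=> //; first by lia.
  (* If row [i] keeps all openings of [x], then [x] has room there too, so [psum a i] is squeezed
     between [psum f i.+1] and [psum x i], which are equal. *)
  move=> lt_n; have [/Pe // | ge_ax] := ltnP (a i) (x i).
  have := leq_psum i le_ax; have := Pf i.
  by have := ei; lia.
- split=> [i | i j lt_ij lt_ax]; first by have [? _ _] := Hx i.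
  have [xj fj ej] := Hx j.
  (* Room in row [j] of [x] would give [psum f j.+1 = psum x j], which exceeds [psum a j], against
     [Pf]. *)
  have lt_p : psum a j < psum x j.
    rewrite /psum (bigD1 i) //= [ltnRHS](bigD1 i) //= -addSn leq_add //.
    exact: leq_sum.
  by have := Pf j; lia.
Qed.

(** With equal totals, [x] and [y] could differ only by crossing. The one that is larger in the
    upper of two such rows is full in the lower row, hence not smaller there. *)
Lemma fills_leq a f x y :
    fills a f x -> fills a f y -> ssum x 0 = ssum y 0 ->
  forall i, y i <= x i.
Proof.
move=> [Hx Hxj] [Hy Hyj] eq_xy i; rewrite leqNgt; apply/negP => lt_xy.
have [j lt_yx] : exists j, y j < x j.
  apply/existsP; apply/contraT; rewrite negb_exists => /forallP le_xy.
  suff: ssum x 0 < ssum y 0 by rewrite eq_xy ltnn.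
  rewrite /ssum (bigD1 i) //= [ltnRHS](bigD1 i) //= -addSn leq_add //.
  by apply: leq_sum => j _; rewrite leqNgt.
have := Hx i; have := Hx j; have := Hy i; have := Hy j.
have [lt_ij | lt_ji | /val_inj eq_ij] := ltngtP i j.
- by have := Hyj _ _ lt_ij; lia.
- by have := Hxj _ _ lt_ji; lia.
- by subst j; lia.
Qed.

Lemma fills_inj a f x y :
    fills a f x -> fills a f y -> ssum x 0 = ssum y 0 -> x =1 y.
Proof.
move=> fx fy eq_xy i; apply/eqP.
by rewrite eqn_leq (fills_leq fx fy eq_xy) (fills_leq fy fx (esym eq_xy)).
Qed.

(** Equal totals say that every opening bracket is matched; those from row [t] on are then matched
    strictly below [t]. *)
Lemma balancedP a f : 0 < m -> forbids a f ->
  (forall t : 'I_m, ssum a t <= ssum (fun i => n - a i) t.+1) <->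
  ssum a 0 = ssum f 0.
Proof.
move=> m_gt0 Hf; set c := fun i => n - a i.
have le_fc k : ssum f k <= ssum c k.
  by apply: leq_sum => i _; have [? _ _] := Hf i; rewrite /c; lia.
have lt_m : m.-1 < m by lia.
split=> [Ha | eq_af t]; last first.
  have [_ + _] := Hf t; have := psum_ssum f t.+1; have := psum_ssum a t.
  by have := le_fc t.+1; lia.
(* If openings from above stay pending after a row, all its closings are matched and the bound is
   inherited; if none do, the hypothesis at that row gives it anew. At the last row it reads
   [ssum a 0 <= ssum f 0]. *)
have le_a k : k < m -> ssum a 0 <= psum f k.+1 + ssum c k.+1.
  elim: k => [|k IH] lt_km; have [_ /= le_fa eq_fa] := Hf (Ordinal lt_km).
    by have /= := Ha (Ordinal lt_km); lia.
  have [ge_af | lt_fa] := leqP (psum a k.+1) (psum f k.+2).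
    have /= := Ha (Ordinal lt_km); have := psum_ssum a k.+1; lia.
  have := IH (ltnW lt_km); have := ssumS c (Ordinal lt_km).
  by have := psumS f (Ordinal lt_km) => /=; rewrite {2}/c; lia.
have := le_a _ lt_m; have [_ + _] := Hf (Ordinal lt_m) => /=.
have := psum_ssum f m; have := psum_leq_range a (ltnW lt_m); have := psum_ssum a m.
by rewrite (ltn_predK m_gt0) !(ssum_oversize _ (leqnn m)); lia.
Qed.

End Matching.

(** * The index set and the tableaux *)

Section Tableaux.
Variables m n : nat.
Implicit Types a b : Nvec m n.

(** One inequality, extended to the last row, covers all three conditions: the last [t] makes the
    last coordinate zero, and [t = 0] bounds the rank by half of [m * n]. *)
Lemma SsetP a :
  reflect (forall t : 'I_m, ssum (fun i => a i : nat) t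
                              <= ssum (fun i => n - a i) t.+1)
          (a \in Sset m n).
Proof.
rewrite inE; apply: (iffP and3P) => [[/forallP a0 _ /forallP Ha] t | Ha].
  have [lt_tm | ge_tm] := ltnP t.+1 m; last first.
    rewrite ssumS (ssum_oversize _ ge_tm) addn0.
    have /eqP Dt : t.+1 == m by have := ltn_ord t; lia.
    by have := a0 t; rewrite Dt eqxx => /eqP->.
  have := Ha t; rewrite lt_tm; congr (_ <= _).
  rewrite /ssum [RHS](bigID (fun i : 'I_m => i.+1 < m)) /=.
  rewrite [X in _ = _ + X]big1 ?addn0 // => i /andP[_ ge_im].
  have /eqP Di : i.+1 == m by have := ltn_ord i; lia.
  by have := a0 i; rewrite Di eqxx => /eqP.
split; [apply/forallP=> i | | apply/forallP=> t].
- apply/implyP => /eqP Di; have := Ha i; rewrite ssumS !ssum_oversize ?Di //.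
  by rewrite addn0 leqn0.
- rewrite leq_divRL //; have [m0 | m_gt0] := posnP m.
    by rewrite /rank big1 // => i; have := ltn_ord i; rewrite {2}m0.
  have := Ha (Ordinal m_gt0); have := ssumS (fun i => n - a i) (Ordinal m_gt0).
  have -> : m * n = ssum (fun i => n - a i) 0 + rank a.
    rewrite /rank -big_split /= (eq_bigr (fun=> n)) ?sum_nat_const ?card_ord //.
    by move=> i _; rewrite subnK // -ltnS.
  by rewrite /= -[rank a]/(ssum (fun i => a i : nat) 0); lia.
- apply/implyP => lt_tm; apply: leq_trans (Ha t).
  rewrite /ssum [leqRHS](bigID (fun i : 'I_m => i.+1 < m)) /=; exact: leq_addr.
Qed.

(** * Reading orders and the count of forbidden cells by rows *)

Lemma card_set_rows (A : {set cell m n}) (P : pred 'I_m) :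
  #|[set x in A | P x.1]| = \sum_(i | P i) #|[set x in A | x.1 == i]|.
Proof.
rewrite -sum1_card (partition_big (fun x => x.1) P) => [|x]; last first.
  by rewrite inE => /andP[].
apply: eq_bigr => i Pi; rewrite -sum1_card; apply: eq_bigl => x.
by rewrite !inE; case: eqP => [-> |_]; rewrite ?Pi ?andbF ?andbT.
Qed.

Lemma pairwise_allpairs_fst (S T : eqType) (e : rel S) (s : seq S) (t : seq T) :
    reflexive e -> pairwise e s ->
  pairwise (fun x y : S * T => e x.1 y.1) [seq (u, v) | u <- s, v <- t].
Proof.
move=> ee; elim: s => //= u s IH /andP[/allP es ps].
rewrite pairwise_cat IH // andbT; apply/andP; split.
  apply/allrelP => _ y /mapP[v _ ->] /allpairsP[z [zs _ ->]] /=.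
  exact: es.
rewrite pairwise_map; elim: (t) => //= v t' ->; rewrite andbT.
by apply/allP => w _ /=; apply: ee.
Qed.

Lemma sorted_enum_ord k : sorted (relpre val leq) (enum 'I_k).
Proof. by rewrite -sorted_map val_enum_ord iota_sorted. Qed.

Lemma cells_belowE (i : 'I_m) y : (y \in cells_below n i) = (i < y.1).
Proof.
apply/allpairsP/idP => [[[r c] /= [+ _ ->]]|lt_iy].
  by rewrite mem_filter => /andP[].
by exists y; rewrite mem_filter mem_enum mem_rev mem_enum lt_iy; case: y lt_iy.
Qed.

Lemma cells_below_uniq (i : 'I_m) : uniq (cells_below n i).
Proof.
apply: allpairs_uniq => [||[? ?] [? ?] _ _ [-> ->]] //.
  exact/filter_uniq/enum_uniq.
by rewrite rev_uniq enum_uniq.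
Qed.

Lemma cells_below_pairwise (i : 'I_m) :
  pairwise (fun y z : cell m n => y.1 <= z.1) (cells_below n i).
Proof.
apply: (@pairwise_allpairs_fst _ _ (relpre val leq)); first exact: (fun=> leqnn _).
rewrite pairwise_filter // -sorted_pairwise ?sorted_enum_ord //.
by move=> y x z; apply: leq_trans.
Qed.

(** The list [s] is arbitrary to allow induction by appending a row [k]. A cell left free below row
    [k] shows that [a k] cells were really taken, all before it in reading order and so in no lower
    row. *)
Lemma foldl_forbidP a (s : seq 'I_m) (R := foldl (forbid a) set0 s) :
  [/\ forall y, y \in R -> y \notin fixed_cells a,
      forall i : 'I_m,
        #|[set y in R | y.1 <= i]| <= \sum_(k <- s | k < i) a k
    & forall y, y \notin fixed_cells a -> y \notin R ->
        #|[set z in R | z.1 <= y.1]| = \sum_(k <- s | k < y.1) a k].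
Proof.
rewrite {}/R; elim/last_ind: s => [|s k].
  split=> [y|i|y _ _] /=; rewrite ?inE // ?big_nil.
    by rewrite leqn0 cards_eq0; apply/eqP/setP => y; rewrite !inE.
  by apply/eqP; rewrite cards_eq0; apply/eqP/setP => z; rewrite !inE.
rewrite foldl_rcons; set F := foldl _ _ _ => -[fixF leF eqF].
rewrite /forbid; set L := [seq x <- _ | _]; set T := take _ L.
have inL y : (y \in L) = [&& y \notin fixed_cells a, y \notin F & k < y.1].
  by rewrite mem_filter cells_belowE andbA.
have uL : uniq L by apply/filter_uniq/cells_below_uniq.
have pL : pairwise (fun y z : cell m n => y.1 <= z.1) L.
  exact/pairwise_filter/cells_below_pairwise.
(* The newly forbidden cells lie outside [F], so the counts add up. *)
have card_step (P : pred 'I_m) :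
    #|[set y in F :|: [set z in T] | P y.1]|
      = #|[set y in F | P y.1]| + count (fun y => P y.1) T.
  have -> : [set y in F :|: [set z in T] | P y.1]
      = [set y in F | P y.1] :|: [set z in [seq z <- T | P z.1]].
    by apply/setP => y; rewrite !inE mem_filter andb_orl [P _ && (_ \in T)]andbC.
  rewrite cardsU disjoint_setI0 ?cards0 ?subn0; last first.
    rewrite -setI_eq0; apply/eqP/setP => y; rewrite !inE mem_filter.
    by apply/negP => /and3P[/andP[yF _] _ /mem_take]; rewrite inL yF andbF.
  congr (_ + _); rewrite cardsE (card_uniqP _) ?size_filter //.
  by rewrite filter_uniq ?take_uniq.
have sumE i : \sum_(j <- rcons s k | j < i) a j
    = \sum_(j <- s | j < i) a j + (if k < i then a k : nat else 0).
  by rewrite big_rcons.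
have count0 i : i <= k -> count (fun y : cell m n => y.1 <= i) T = 0.
  move=> le_ik; apply/eqP; rewrite -leqn0 leqNgt -has_count; apply/hasPn => y.
  by move/mem_take; rewrite inL => /and3P[_ _ lt_ky]; rewrite -ltnNge; lia.
split=> [y|i|y fixy].
- rewrite in_setU => /orP[/fixF // | ]; rewrite inE => /mem_take.
  by rewrite inL => /andP[].
- rewrite (card_step (fun j => j <= i)) sumE leq_add //.
  case: ltnP => [_ | /count0 -> //]; apply: leq_trans (count_size _ _) _.
  by rewrite size_take_min geq_minl.
- rewrite !inE negb_or => /andP[yF yT].
  rewrite (card_step (fun j => j <= y.1)) sumE eqF //; congr (_ + _).
  case: ltnP => [lt_ky | /count0 -> //].
  have : y \in L by rewrite inL fixy yF.
  rewrite -(cat_take_drop (a k) L) mem_cat -/T (negPf yT) /= => yD.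
  have size_T : size T = a k.
    apply: size_takel; rewrite leqNgt; apply/negP => lt_La.
    by rewrite drop_oversize ?in_nil // ltnW in yD.
  rewrite -[RHS]size_T; apply/eqP; rewrite -all_count; apply/allP => z zT.
  move: pL; rewrite -(cat_take_drop (a k) L) pairwise_cat => /and3P[/allrelP pTD _ _].
  exact: pTD.
Qed.

Lemma card_row (i : 'I_m) : #|[set y : cell m n | y.1 == i]| = n.
Proof.
have -> : [set y : cell m n | y.1 == i] = setX [set i] setT.
  by apply/setP => y; rewrite !inE andbT.
by rewrite cardsX cards1 cardsT card_ord mul1n.
Qed.

Lemma card_fixed_row a (i : 'I_m) : #|[set y in fixed_cells a | y.1 == i]| = a i.
Proof.
have -> : [set y in fixed_cells a | y.1 == i] = setX [set i] [set c : 'I_n | c < a i].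
  by apply/setP => y; rewrite !inE andbC; case: eqP => // ->.
rewrite cardsX cards1 mul1n cardsE -sum1_card.
by rewrite (big_ord_narrow (n2 := n)) ?sum1_card ?card_ord // -ltnS.
Qed.

Lemma card_fillable_row a (i : 'I_m) :
  a i + forbidden_in_row a i + #|[set y in fillable_cells a | y.1 == i]| = n.
Proof.
have [fixR _ _] := foldl_forbidP a [seq k : 'I_m <- enum 'I_m | k.+1 < m].
rewrite -[RHS](card_row i) -[RHS](cardsID (fixed_cells a)) -addnA; congr (_ + _).
  by rewrite -(card_fixed_row a i) setIC; apply: eq_card => y; rewrite !inE.
rewrite -[RHS](cardsID (forbidden_cells a)) /forbidden_in_row; congr (_ + _).
  apply: eq_card => y; rewrite !inE; have := fixR y.
  rewrite -/(forbidden_cells a) inE.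
  by case: (y \in _) => [->|]; rewrite ?andbT ?andbF.
apply: eq_card => y; rewrite !inE andbA [X in X && _]andbC.
by congr (_ && _); rewrite andbC.
Qed.

(** Links tableaux to matching: room in row [i] means a fillable cell there, and at such a cell the
    bound of [foldl_forbidP] is an equality. *)
Lemma forbidden_in_rowP a : forbids n (fun i => a i : nat) (forbidden_in_row a).
Proof.
move=> i; have cardi := card_fillable_row a i.
have [_ le_R eq_R] := foldl_forbidP a [seq k : 'I_m <- enum 'I_m | k.+1 < m].
rewrite -/(forbidden_cells a) in le_R eq_R.
have psumE (j : 'I_m) : psum (forbidden_in_row a) j.+1
    = #|[set y in forbidden_cells a | y.1 <= j]|.
  by rewrite (card_set_rows _ (fun k => k <= j)).
(* The list omits the last row, which [k < j] excludes as well. *)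
have sumE (j : 'I_m) : \sum_(k <- [seq j : 'I_m <- enum 'I_m | j.+1 < m] | k < j) a k
    = psum (fun i => a i : nat) j.
  rewrite big_filter_cond big_enum_cond; apply: eq_bigl => k /=.
  by have := ltn_ord j; lia.
split; first by lia.
  by rewrite psumE -sumE.
move=> lt_n; have : 0 < #|[set y in fillable_cells a | y.1 == i]| by lia.
case/card_gt0P => y; rewrite inE => /andP[]; rewrite inE => /andP[fixy Ry] /eqP Dy.
by rewrite psumE -sumE -Dy eq_R.
Qed.

Lemma card_fillable a :
  rank a + \sum_i forbidden_in_row a i + #|fillable_cells a| = m * n.
Proof.
have -> : #|fillable_cells a|
    = \sum_i #|[set y in fillable_cells a | y.1 == i]|.
  by rewrite -(card_set_rows _ predT); apply: eq_card => y; rewrite inE andbT.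
rewrite /rank -!big_split /= (eq_bigr (fun=> n)) ?sum_nat_const ?card_ord //.
by move=> i _; rewrite card_fillable_row.
Qed.

(** * The filling order and the elements of a chain *)

Lemma filling_orderE a y : (y \in filling_order a) = (y \in fillable_cells a).
Proof.
rewrite mem_filter andbC; case: allpairsP => //= -[].
by exists y; rewrite mem_rev !mem_enum; case: y.
Qed.

Lemma filling_order_uniq a : uniq (filling_order a).
Proof.
apply/filter_uniq/allpairs_uniq => [||[? ?] [? ?] _ _ [-> ->]] //.
  by rewrite rev_uniq enum_uniq.
exact: enum_uniq.
Qed.

Lemma filling_order_pairwise a :
  pairwise (fun y z : cell m n => z.1 <= y.1) (filling_order a).
Proof.
apply/pairwise_filter.
apply: (@pairwise_allpairs_fst _ _ (relpre val geq)); first exact: (fun=> leqnn _).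
rewrite -sorted_pairwise ?rev_sorted ?sorted_enum_ord //.
by move=> y x z /= le_yx le_zy; apply: leq_trans le_yx.
Qed.

Lemma entry_lt a y z : y \in fillable_cells a -> z \in fillable_cells a ->
  y.1 < z.1 -> entry a z < entry a y.
Proof.
move=> fy fz; apply: contraLR; rewrite ltnS -!leqNgt leq_eqVlt.
rewrite -!filling_orderE in fy fz.
case/orP => [/eqP eq_yz | lt_yz]; last first.
  have /(pairwiseP y)/(_ _ _ _ _ lt_yz) := filling_order_pairwise a.
  by rewrite !inE !index_mem !nth_index //; apply.
by rewrite -(nth_index y fy) eq_yz nth_index.
Qed.

(** Entries are positions plus one, so these cells form the prefix of length [r] of the filling
    order. *)
Lemma card_filled a r : r <= #|fillable_cells a| ->
  #|[set y in fillable_cells a | entry a y <= r]| = r.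
Proof.
have szE : size (filling_order a) = #|fillable_cells a|.
  rewrite -(card_uniqP (filling_order_uniq a)); apply: eq_card => y.
  exact: filling_orderE.
rewrite -szE => le_r; rewrite -[RHS](size_takel le_r).
rewrite -(card_uniqP (take_uniq _ (filling_order_uniq a))).
apply: eq_card => y; rewrite inE -filling_orderE.
have [yO | yNO] := boolP (y \in filling_order a); first by rewrite in_take.
by apply/esym/negP => /mem_take; apply/negP.
Qed.

Lemma rank_chain_elt a r :
  r <= #|fillable_cells a| -> rank (chain_elt a r) = rank a + r.
Proof.
move=> le_r; rewrite /rank -[in RHS](card_filled le_r).
set B := [set y in fillable_cells a | entry a y <= r].
have -> : #|B| = \sum_i #|[set y in B | y.1 == i]|.
  by rewrite -(card_set_rows _ predT); apply: eq_card => y; rewrite inE andbT.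
rewrite -big_split; apply: eq_bigr => i _; rewrite ffunE /=; congr (_ + _).
apply: eq_card => y; rewrite !in_set -!andbA; do 2 congr (_ && _).
exact: andbC.
Qed.

(** A raised row contains an entry at most [r]; all fillable cells in lower rows have smaller
    entries and are filled already. *)
Lemma fills_chain_elt a r :
  fills n (fun i => a i : nat) (forbidden_in_row a)
    (fun i => chain_elt a r i : nat).
Proof.
split=> [i|i j lt_ij]; rewrite !ffunE /=.
  split; first exact: leq_addr.
  rewrite -[leqRHS](card_fillable_row a i) addnAC leq_add2l subset_leq_card //.
  by apply/subsetP => y; rewrite !in_set => /and3P[-> ->].
rewrite -[ltnLHS]addn0 ltn_add2l => /card_gt0P[y].
rewrite in_set => /and3P[fy /eqP Dy le_yr].
rewrite -[RHS](card_fillable_row a j) addnAC; congr (_ + _).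
apply: eq_card => z; rewrite !in_set; apply: andb_id2l => fz.
case: eqP => //= Dz; apply: leq_trans le_yr; apply: ltnW.
apply: entry_lt => //; first by rewrite !in_set.
by rewrite Dy Dz.
Qed.

(** For the converse, [x] is compared with the chain element of the same rank: [fills_inj] makes
    them equal. *)
Lemma chainP a (x : Nvec m n) :
  reflect (fills n (fun i => a i : nat) (forbidden_in_row a) (fun i => x i : nat))
          (x \in chain a).
Proof.
apply: (iffP mapP) => [[r _ ->] | fx]; first exact: fills_chain_elt.
have [Hx _] := fx; have le_ax : rank a <= rank x.
  by apply: leq_sum => i _; have [] := Hx i.
have le_r : rank x - rank a <= #|fillable_cells a|.
  have : rank x + \sum_i forbidden_in_row a i <= m * n.
    rewrite -big_split -[m in m * n]card_ord -sum_nat_const.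
    by apply: leq_sum => i _; have [] := Hx i.
  by have := card_fillable a; lia.
exists (rank x - rank a); first by rewrite mem_iota add0n ltnS.
apply/ffunP => i; apply: val_inj.
apply: (fills_inj fx (fills_chain_elt _ _)).
by rewrite -[RHS]/(rank _) rank_chain_elt // subnKC.
Qed.

(** The ranks differ by one and the order strictly raises the rank, so nothing fits in between. *)
Lemma chain_elt_covered a r : r < #|fillable_cells a| ->
  covered_by (chain_elt a r) (chain_elt a r.+1).
Proof.
move=> lt_r; have rkE := rank_chain_elt (ltnW lt_r).
have rkSE := rank_chain_elt lt_r.
apply/andP; split.
  apply/andP; split; last by rewrite rkE rkSE addnS.
  apply/forallP => i; rewrite !ffunE leq_add2l subset_leq_card //.
  apply/subsetP => y; rewrite !in_set => /and3P[-> -> le_yr] /=.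
  exact: leqW.
apply/forallP => z; apply/negP => /andP[/andP[_ lt_z] /andP[_ lt_zr]].
by rewrite rkE rkSE in lt_z lt_zr; lia.
Qed.

(** * Symmetry, disjointness and covering *)

Lemma poset_rankE : poset_rank (@rank m n) = m * n.
Proof.
apply/eqP; rewrite eqn_leq; apply/andP; split.
  apply/bigmax_leqP => a _; rewrite -[m in leqRHS]card_ord -sum_nat_const.
  by apply: leq_sum => i _; rewrite -ltnS.
have <- : rank ([ffun=> ord_max] : Nvec m n) = m * n.
  rewrite /rank (eq_bigr (fun=> n)) ?sum_nat_const ?card_ord // => i _.
  by rewrite ffunE.
exact: (leq_bigmax_cond (F := @rank m n)).
Qed.

Lemma SsetE a : 0 < m ->
  (a \in Sset m n) = (rank a == \sum_i forbidden_in_row a i).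
Proof.
move=> m_gt0; have [to_eq of_eq] := balancedP m_gt0 (forbidden_in_rowP a).
by apply/SsetP/eqP.
Qed.

Lemma rank_chain_end a : rank (chain_end a) + \sum_i forbidden_in_row a i = m * n.
Proof.
rewrite -big_split /= (eq_bigr (fun=> n)) ?sum_nat_const ?card_ord // => i _.
by rewrite ffunE /=; have := card_fillable_row a i; lia.
Qed.

Lemma chain_symmetric a : 0 < m -> a \in Sset m n ->
  symmetric_chain (@rank m n) (chain a).
Proof.
move=> m_gt0; rewrite SsetE // => /eqP eq_af.
(* The segment may start at any [s], since the induction on its length moves the start. *)
have chain_path s l : s + l <= #|fillable_cells a| ->
    path (@covered_by _ _) (chain_elt a s) (map (chain_elt a) (iota s.+1 l))
    /\ last (chain_elt a s) (map (chain_elt a) (iota s.+1 l)) = chain_elt a (s + l).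
  elim: l s => [|l IH] s le_sl /=; first by rewrite addn0.
  have [|-> ->] := IH s.+1; first by rewrite addSnnS.
  by rewrite chain_elt_covered ?addSnnS //; lia.
have [/= -> ->] := chain_path 0 _ (leqnn _).
rewrite poset_rankE !rank_chain_elt // -(card_fillable a) -eq_af.
by rewrite addn0 addnA eqxx.
Qed.

(** By [fills_forbids], both forbidden counts are the matching of [x] itself, hence equal; [x] and
    these counts then determine the start. *)
Lemma chain_disjoint a b (x : Nvec m n) : 0 < m -> a \in Sset m n -> b \in Sset m n ->
  x \in chain a -> x \in chain b -> a = b.
Proof.
move=> m_gt0; rewrite !SsetE // => /eqP sa /eqP sb /chainP xa /chainP xb.
have fa := forbidden_in_rowP a; have fb := forbidden_in_rowP b.
have eq_f := forbids_inj (fills_forbids fb xb) (fills_forbids fa xa).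
have fb' := eq_forbids (fun=> erefl) eq_f fb.
have xb' := eq_fills (fun=> erefl) eq_f xb.
apply/ffunP => i; apply: val_inj.
apply: (fills_start_inj fa sa xa fb' _ xb').
by rewrite -[LHS]/(rank b) sb; apply: eq_bigr.
Qed.

(** The tableau rule is applied to [x] itself, whether or not [x] is in S. Its forbidden counts
    yield a start [a], and by uniqueness they are also those of the tableau of [a]. *)
Lemma chain_cover (x : Nvec m n) : 0 < m -> exists2 a, a \in Sset m n & x \in chain a.
Proof.
move=> m_gt0; have [c [fc sc xc]] := fills_start_exists m_gt0 (forbidden_in_rowP x).
have le_cn i : c i < n.+1 by have [? _ _] := fc i; lia.
pose a : Nvec m n := [ffun i => Ordinal (le_cn i)].
have eq_ca : c =1 (fun i => a i : nat) by move=> i; rewrite ffunE.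
have fa := eq_forbids eq_ca (fun=> erefl) fc.
have eq_f := forbids_inj fa (forbidden_in_rowP a).
exists a; last exact/chainP/(eq_fills eq_ca eq_f xc).
rewrite SsetE //; apply/eqP; rewrite /rank.
rewrite -(eq_bigr _ (fun i _ => eq_f i)) -(eq_bigr _ (fun i _ => eq_ca i)).
exact: sc.
Qed.

End Tableaux.

Theorem theorem1 (m n : nat) (hm : 0 < m) (hn : 0 < n) :
  [/\ symmetric_chain_decomposition (@rank m n) (Sset m n) (@chain m n),
      \bigcup_(a in Sset m n) [set x in chain a] = [set: Nvec m n],
      forall a b : Nvec m n, a \in Sset m n -> b \in Sset m n -> a != b ->
        [set x in chain a] :&: [set x in chain b] = set0
    & forall a : Nvec m n, a \in Sset m n ->
        rank (chain_start a) + rank (chain_end a) = m * n].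
Proof.
split; first split.
- by move=> a; apply: chain_symmetric.
- by move=> x; apply: chain_cover.
- move=> a b aS bS; apply: contraNT => /pred0Pn[x /andP[xa xb]].
  by rewrite (chain_disjoint hm aS bS xa xb).
- apply/setP => x; rewrite in_setT; apply/bigcupP.
  by have [a aS xa] := chain_cover x hm; exists a; rewrite // in_set.
- move=> a b aS bS; apply: contraNeq => /set0Pn[x].
  rewrite !inE => /andP[xa xb].
  by apply/eqP; apply: chain_disjoint hm aS bS xa xb.
- move=> a; rewrite SsetE // => /eqP eq_af.
  by rewrite /chain_start eq_af addnC rank_chain_end.
Qed.
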